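(* For every nonnegative integer $n$, let $\ell^{(2)}_m(n)=|\mathcal{L}^{(2)}_{n,m}|$ denote the number of $W_2$-hesitating lattice walks of length $2n$ starting at $(2,1)$ and ending at $(m+2,1)$. Then \[\sum_{m=0}^{n}\ell^{(2)}_m(n)=B_{n+1},\] where $B_N=\sum_{j=1}^{N}\frac{\binom{N+1}{j-1}\binom{N+1}{j}\binom{N+1}{j+1}}{\binom{N+1}{1}\binom{N+1}{2}}$ is the $N$-th Baxter number (the number of Baxter permutations of size $N$).
   Context: Let $W_2=\{(x_1,x_2)\in\mathbb{Z}^2: x_1>x_2>0\}$, and let $e_1,e_2$ be the standard unit vectors; a stay step is the zero step. A $W_2$-hesitating walk of length $2n$ is a sequence of $2n$ steps grouped into $n$ consecutive pairs, each pair being one of: (i) a stay step followed by a step $e_i$; (ii) a step $-e_i$ followed by a stay step; (iii) a step $e_i$ followed by a step $-e_j$ ($i,j\in\{1,2\}$), such that every visited point lies in $W_2$. *)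

(* Defs.v *)
From HB Require Import structures.
From mathcomp Require Import all_boot all_order all_algebra.

Set Implicit Arguments.
Unset Strict Implicit.
Unset Printing Implicit Defensive.

Import Order.TTheory GRing.Theory Num.Theory.

Local Open Scope ring_scope.

Definition point : zmodType := (int * int)%type.

Definition W2 (x : point) : bool := 0 < x.2 < x.1.

(* Coordinates are numbered from 0: [ord0] is the first one. *)
Definition unit_vector (i : 'I_2) : point := if i == ord0 then (1, 0) else (0, 1).

Inductive step : Type := Stay | Plus of 'I_2 | Minus of 'I_2.

Definition step_code (s : step) : option ('I_2 + 'I_2) :=
  match s with
  | Stay => None
  | Plus i => Some (inl i)
  | Minus i => Some (inr i)
  end.

Definition step_decode (c : option ('I_2 + 'I_2)) : step :=
  match c with
  | None => Stay
  | Some (inl i) => Plus i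
  | Some (inr i) => Minus i
  end.

Lemma step_codeK : cancel step_code step_decode.
Proof. by case. Qed.

HB.instance Definition _ := Finite.copy step (can_type step_codeK).

Definition displacement (s : step) : point :=
  match s with
  | Stay => 0
  | Plus i => unit_vector i
  | Minus i => - unit_vector i
  end.

Definition move (x : point) (s : step) : point := x + displacement s.

Definition endpoint (x : point) (w : seq step) : point := foldl move x w.

Definition visited (x : point) (w : seq step) : seq point := x :: scanl move x w.

Definition hesitating_pair (s t : step) : bool :=
  match s, t with
  | Stay, Plus _ => true
  | Minus _, Stay => true
  | Plus _, Minus _ => true
  | _, _ => false
  end.

Definition hesitating_walk (n : nat) (x : point) (w : (2 * n).-tuple step) : bool :=
  [forall k : 'I_n, hesitating_pair (nth Stay w (2 * k)) (nth Stay w (2 * k).+1)]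
  && all W2 (visited x w).

(* Once the starting point is fixed, a walk is determined by its steps. *)
Definition hesitating_walks (n : nat) (x y : point) : {set (2 * n).-tuple step} :=
  [set w | hesitating_walk x w & endpoint x w == y].

Definition L2 (n m : nat) : {set (2 * n).-tuple step} :=
  hesitating_walks n (2, 1) (m%:Z + 2, 1).

Definition ell2 (m n : nat) : nat := #|L2 n m|.

(* Meant for N >= 1: the empty sum makes [baxter 0 = 0]. *)
Definition baxter (N : nat) : rat :=
  \sum_(1 <= j < N.+1)
     ('C(N.+1, j.-1)%:R * 'C(N.+1, j)%:R * 'C(N.+1, j.+1)%:R)
     / ('C(N.+1, 1)%:R * 'C(N.+1, 2)%:R).

(* Main.v *)
Require Import Defs.
From mathcomp Require Import all_boot all_order all_algebra.
From mathcomp Require Import zify ring.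

(* The Laurent polynomial of a pair of steps, S = (1 + x + y)(1 + 1/x + 1/y) - 1, factors as (1 + x)(1 + y)(x + y) / (x y). It is invariant under the group of order 12 generated by (a, b) -> (b, a) and (a, b) -> (a + b, - b), acting on exponents, for which W2 is a Weyl chamber (type G2). By the reflection principle the number of walks of length 2n from x to y is the sum over w in the group of sgn(w) [X^(y - w x)] S^n, and the factorisation gives [X^(a, b)] S^n = sum_k C(n, k) C(n, k - a) C(n, k + b).
   Summing over the endpoints (m + 2, 1), the 12 terms pair up and telescope, and the symmetries leave the sum over k of the determinants of the 3x3 matrices (C(n, k + i - j)), which are the terms of the Baxter number. *)

Set Implicit Arguments.
Unset Strict Implicit.
Unset Printing Implicit Defensive.

Import Order.TTheory GRing.Theory Num.Theory.

Local Open Scope ring_scope.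

(** * Binomials with integer lower index and the coefficients of the powers of S *)

Definition binz (n : nat) (k : int) : int := if k is Posz j then 'C(n, j)%:Z else 0.

Lemma binzS n k : binz n.+1 k = binz n k + binz n (k - 1).
Proof.
case: k => [[|k]|k] //; first by rewrite /= !bin0.
have -> : k.+1%:Z - 1 = k by lia.
by rewrite /= binS PoszD.
Qed.

Lemma binz_small n (k : int) : n%:Z < k -> binz n k = 0.
Proof. by case: k => [k|k] //= h; rewrite bin_small //; lia. Qed.

Lemma binz_neg n (k : int) : k < 0 -> binz n k = 0.
Proof. by case: k. Qed.

(** Multiplication by S on arrays of coefficients. The two copies of [f a b] come from the pairs
    [e_i], [-e_i] for the two values of [i]. The displacements are closed under negation, so the
    same operator also expresses recursion on the starting point. *)
Definition step_sum (f : int -> int -> int) (a b : int) : int :=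
  f a b + f a (b - 1) + f (a + 1) b + f (a + 1) (b - 1) +
  f (a - 1) (b + 1) + f (a - 1) b + f a (b + 1) + f a b.

(* The coefficient of [x^a y^b] in [((1 + x) (1 + y) (x + y) / (x y))^n]. *)
Definition coefS (n : nat) (a b : int) : int :=
  \sum_(k < n.+1) binz n k%:Z * binz n (k%:Z - a) * binz n (k%:Z + b).

Lemma coefS0 a b : coefS 0 a b = ((a == 0) && (b == 0))%:Z.
Proof.
rewrite /coefS big_ord1 /= mul1r sub0r add0r.
by case: a => [[|a]|a]; case: b => [[|b]|b].
Qed.

Lemma coefSS n a b : coefS n.+1 a b = step_sum (coefS n) a b.
Proof.
pose T a b (k : int) := binz n k * binz n (k - a) * binz n (k + b).
(* On the longer range the extra term has first binomial of index [n + 1] (here) or [-1] (in [T1]),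
   hence vanishes. Pascal's rule on the three factors then yields the eight terms of [step_sum]. *)
have T0 a' b' : \sum_(k < n.+2) T a' b' k%:Z = coefS n a' b'.
  by rewrite big_ord_recr /= /T binz_small ?mul0r ?addr0 //; lia.
have T1 a' b' : \sum_(k < n.+2) T a' b' (k%:Z - 1) = coefS n a' b'.
  rewrite big_ord_recl {1}/T binz_neg // !mul0r add0r.
  by apply: eq_bigr => i _; congr (T _ _ _); rewrite lift0; lia.
rewrite /step_sum -[in X in X + _]T0 -(T0 a (b - 1)) -(T0 (a + 1) b) -(T0 (a + 1) (b - 1)).
rewrite -(T1 (a - 1) (b + 1)) -(T1 (a - 1) b) -(T1 a (b + 1)) -(T1 a b) -!big_split /=.
apply: eq_bigr => k _; rewrite /T !binzS.
have -> : k%:Z - (a + 1) = k%:Z - a - 1 by ring.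
have -> : k%:Z + (b - 1) = k%:Z + b - 1 by ring.
have -> : k%:Z - 1 - (a - 1) = k%:Z - a by ring.
have -> : k%:Z - 1 - a = k%:Z - a - 1 by ring.
have -> : k%:Z - 1 + (b + 1) = k%:Z + b by ring.
have -> : k%:Z - 1 + b = k%:Z + b - 1 by ring.
ring.
Qed.

(** * Symmetries of S and of its powers *)

Lemma eq_step_sum f g : f =2 g -> step_sum f =2 step_sum g.
Proof. by move=> fg a b; rewrite /step_sum !fg. Qed.

Lemma step_sum_swap f a b : step_sum (fun u v => f v u) a b = step_sum f b a.
Proof. rewrite /step_sum; ring. Qed.

Lemma step_sum_rot f a b :
  step_sum (fun u v => f (u + v) (- u)) a b = step_sum f (a + b) (- a).
Proof.
rewrite /step_sum !opprD !opprK.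
have -> : a + (b - 1) = a + b - 1 by ring.
have -> : a + 1 + b = a + b + 1 by ring.
have -> : a + 1 + (b - 1) = a + b by ring.
have -> : a - 1 + (b + 1) = a + b by ring.
have -> : a - 1 + b = a + b - 1 by ring.
have -> : a + (b + 1) = a + b + 1 by ring.
ring.
Qed.

Lemma step_sum_opp f a b : step_sum (fun u v => f (- u) (- v)) a b = step_sum f (- a) (- b).
Proof. rewrite /step_sum !opprD !opprK; ring. Qed.

Lemma step_sum_shift f p q a b :
  step_sum (fun u v => f (p + u) (q + v)) a b = step_sum f (p + a) (q + b).
Proof. by rewrite /step_sum !addrA. Qed.

(** The triple product of binomials hides the symmetry; it is inherited along the recursion from
    [step_sum] and from the case [n = 0]. *)
Lemma coefS_swap n a b : coefS n a b = coefS n b a.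
Proof.
elim: n a b => [|n IHn] a b; first by rewrite !coefS0 andbC.
by rewrite !coefSS -step_sum_swap; apply: eq_step_sum.
Qed.

Lemma coefS_rot n a b : coefS n a b = coefS n (a + b) (- a).
Proof.
elim: n a b => [|n IHn] a b; first by rewrite !coefS0; congr (nat_of_bool _)%:Z; lia.
by rewrite !coefSS -step_sum_rot; apply: eq_step_sum.
Qed.

Lemma coefS_refl n a b : coefS n a b = coefS n (a + b) (- b).
Proof. by rewrite coefS_swap coefS_rot addrC. Qed.

Lemma coefS_eq0 n (a b : int) : (n%:Z < a) || (n%:Z < a + b) -> coefS n a b = 0.
Proof.
suff H x y : n%:Z < x -> coefS n x y = 0.
  by case/orP=> h; [|rewrite coefS_refl]; apply: H.
move=> h; apply: big1 => k _; rewrite (@binz_neg _ (_ - _)) ?mulr0 ?mul0r //.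
by have := ltn_ord k; lia.
Qed.

(** * Antisymmetrisation over the group and the reflection formula *)

(* The linear maps listed are the powers of the rotation [(a, b) -> (a + b, - a)], of order 6. *)
Definition rot_sum (f : int -> int -> int) (a b : int) : int :=
  f a b + f (a + b) (- a) + f b (- (a + b)) +
  f (- a) (- b) + f (- (a + b)) a + f (- b) (a + b).

(* The six reflections are the rotations composed with the swap. *)
Definition alt_sum f a b := rot_sum f a b - rot_sum f b a.

Lemma alt_sumC f a b : alt_sum f b a = - alt_sum f a b.
Proof. by rewrite /alt_sum opprB. Qed.

(** The lines [a = b] and [b = 0] are the walls of [W2]; each is fixed by a reflection, so the
    signed terms cancel there. *)
Lemma alt_sum_diag f a : alt_sum f a a = 0.
Proof. exact: subrr. Qed.

Lemma alt_sum_axis f a : alt_sum f a 0 = 0.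
Proof. rewrite /alt_sum /rot_sum !(addr0, add0r, oppr0); ring. Qed.

Lemma step_sumD f g a b :
  step_sum (fun u v => f u v + g u v) a b = step_sum f a b + step_sum g a b.
Proof. rewrite /step_sum; ring. Qed.

Lemma step_sumB f g a b :
  step_sum (fun u v => f u v - g u v) a b = step_sum f a b - step_sum g a b.
Proof. rewrite /step_sum; ring. Qed.

Lemma step_sum_rot_sum f a b : step_sum (rot_sum f) a b = rot_sum (step_sum f) a b.
Proof.
have R g := step_sum_rot g.
have O g := step_sum_opp g.
(* The square of the rotation; the fourth and fifth powers are the first and second composed with
   negation, the cube. *)
have R2 g a' b' : step_sum (fun u v => g v (- (u + v))) a' b' = step_sum g b' (- (a' + b')).
  have := R (fun x y => g (x + y) (- x)) a' b'; rewrite R addrAC subrr add0r => <-.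
  by apply: eq_step_sum => u v /=; rewrite addrAC subrr add0r.
rewrite /rot_sum !step_sumD; congr (_ + _ + _ + _ + _ + _) => //.
- by have := R (fun x y => f (- x) (- y)) a b; rewrite O opprK => <-; apply: eq_step_sum => u v; rewrite opprK.
- by have := R2 (fun x y => f (- x) (- y)) a b; rewrite O opprK => <-; apply: eq_step_sum => u v; rewrite opprK.
Qed.

Lemma step_sum_alt_sum f a b : step_sum (alt_sum f) a b = alt_sum (step_sum f) a b.
Proof.
rewrite step_sumB (step_sum_swap (rot_sum f)) !step_sum_rot_sum //.
Qed.

(* Counts the walks from [(a, b)] to [(p, q)] when both points lie in [W2]. *)
Definition walk_count (n : nat) (p q : int) : int -> int -> int :=
  alt_sum (fun u v => coefS n (p - u) (q - v)).

Lemma eq_alt_sum f g : f =2 g -> alt_sum f =2 alt_sum g.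
Proof. by move=> fg a b; rewrite /alt_sum /rot_sum !fg. Qed.

Lemma walk_countS n p q a b :
  walk_count n.+1 p q a b = step_sum (walk_count n p q) a b.
Proof.
rewrite step_sum_alt_sum; apply: eq_alt_sum => u v.
rewrite coefSS -step_sum_shift.
by rewrite (step_sum_opp (fun u v => coefS n (p + u) (q + v))).
Qed.

(** The chamber meets each orbit at most once, with trivial stabiliser, so only the identity term
    can be nonzero. *)
Lemma walk_count0 (p q a b : int) : 0 < q < p -> 0 < b < a ->
  walk_count 0 p q a b = ((p == a) && (q == b))%:Z.
Proof.
move=> hp ha; rewrite /walk_count /alt_sum /rot_sum !coefS0.
have E x y : (x - y == 0) = (x == y) :> bool by rewrite subr_eq0.
rewrite !E.
have N (P : bool) : ~ P -> P%:Z = 0 by case: P.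
do 5 (rewrite [X in _ + X - _]N ?addr0; last lia).
do 5 (rewrite [X in _ - (_ + X)]N ?addr0; last lia).
by rewrite [X in _ - X]N ?subr0 //; lia.
Qed.

(** * Counting walks by their first pair of steps *)

(* [hesitating_walk] and its endpoint condition on bare sequences, so that prepending a pair of steps needs no cast between tuple lengths. *)
Definition walk_between (n : nat) (x y : point) (w : seq step) : bool :=
  [forall k : 'I_n, hesitating_pair (nth Stay w (2 * k)) (nth Stay w (2 * k).+1)]
  && all W2 (visited x w) && (endpoint x w == y).

Lemma walk_between_cons n x y s t w :
  walk_between n.+1 x y [:: s, t & w] =
  [&& W2 x, W2 (move x s), hesitating_pair s t & walk_between n (move (move x s) t) y w].
Proof.
rewrite /walk_between /=.
have -> : [forall k : 'I_n.+1, hesitating_pair (nth Stay [:: s, t & w] (2 * k))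
                                               (nth Stay [:: s, t & w] (2 * k).+1)] =
  hesitating_pair s t &&
  [forall k : 'I_n, hesitating_pair (nth Stay w (2 * k)) (nth Stay w (2 * k).+1)].
  apply/forallP/andP => [h|[h0 /forallP h] k].
    split; first exact: (h ord0).
    by apply/forallP => k; have := h (lift ord0 k); rewrite lift0 mulnS.
  by case: (unliftP ord0 k) => [j|] ->; rewrite ?lift0 ?mulnS //; apply: h.
by case: (W2 x); case: (W2 (move x s)); case: (hesitating_pair s t); rewrite ?andbF ?andbT /=.
Qed.

Definition nwalks (n : nat) (x y : point) : nat :=
  \sum_(w : (2 * n).-tuple step) walk_between n x y w.

Lemma card_hesitating_walks n x y : #|hesitating_walks n x y| = nwalks n x y.
Proof.
rewrite -sum1_card /nwalks [RHS](bigID (fun w : (2 * n).-tuple step => walk_between n x y w)) /=.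
rewrite [X in (_ + X)%N]big1 ?addn0 => [|w /negbTE -> //].
by apply: eq_big => [w|w]; rewrite inE // /hesitating_walk /walk_between => ->.
Qed.

Lemma big_tuple_cons (T : finType) (N : nat) (F : seq T -> nat) :
  (\sum_(w : N.+1.-tuple T) F w = \sum_(s : T) \sum_(w : N.-tuple T) F (s :: w))%N.
Proof.
rewrite pair_big /= (reindex (fun p : T * N.-tuple T => cons_tuple p.1 p.2)) //=.
exists (fun w => (thead w, behead_tuple w)) => [[s w] _|w _] /=.
  by congr (_, _); apply: val_inj.
by rewrite [RHS]tuple_eta.
Qed.

Lemma big_step (F : step -> nat) :
  (\sum_(s : step) F s = F Stay + F (Plus ord0) + F (Plus ord_max) + F (Minus ord0) + F (Minus ord_max))%N.
Proof.
rewrite (perm_big [:: Stay; Plus ord0; Plus ord_max; Minus ord0; Minus ord_max]) /=.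
  by rewrite !big_cons big_nil addn0 !addnA.
apply: uniq_perm => [||s]; rewrite ?index_enum_uniq // mem_index_enum.
case: s => [|i|i] //; rewrite !inE; case: i => [[|[|i]]] //= h;
  by rewrite -!(inj_eq (can_inj step_codeK)).
Qed.

Lemma nwalks_notin n (x y : point) : ~~ W2 x -> nwalks n x y = 0%N.
Proof. by move=> /negbTE h; apply: big1 => w _; rewrite /walk_between /= h andbF. Qed.

Lemma nwalks0 x y : nwalks 0 x y = (W2 x && (x == y)).
Proof.
rewrite /nwalks muln0 (big_pred1 [tuple]) => [|w]; last by rewrite [w]tuple0 [RHS]eqxx.
rewrite /walk_between /= andbT; rewrite (_ : [forall k, _] = true) //.
by apply/forallP => - [].
Qed.

Lemma nwalksS n x y : W2 x ->
  nwalks n.+1 x y = (\sum_(s : step) \sum_(t : step | W2 (move x s) && hesitating_pair s t)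
     nwalks n (move (move x s) t) y)%N.
Proof.
move=> hx; rewrite /nwalks mulnS !addSn add0n (big_tuple_cons _ (fun w => walk_between _ _ _ w : nat)); apply: eq_bigr => s _.
rewrite (big_tuple_cons _ (fun w => walk_between _ _ _ (s :: w) : nat)) [RHS]big_mkcond /=; apply: eq_bigr => t _.
under eq_bigr do rewrite walk_between_cons hx /= andbA.
by case: ifP => _; rewrite // big1.
Qed.

(** Only the midpoint [(a, b + 1)], reached by [e_2], needs an explicit test: [(a + 1, b)] is always
    in [W2], and after [-e_i] the midpoint is also the end of the pair, where [nwalks] vanishes
    outside [W2]. *)
Lemma nwalksS_pairs n (a b : int) y : 0 < b < a ->
  nwalks n.+1 (a, b) y =
  (nwalks n (a + 1, b)%R y + nwalks n (a, b + 1)%R y + nwalks n (a - 1, b)%R y +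
   nwalks n (a, b - 1)%R y + nwalks n (a, b) y + nwalks n (a + 1, b - 1)%R y +
   (if (b + 1 < a)%R then nwalks n (a - 1, b + 1)%R y + nwalks n (a, b) y else 0))%N.
Proof.
move=> hb; rewrite nwalksS ?big_step //.
do ?[rewrite [(\sum_(t : step | _) _)%N]big_mkcond big_step /=].
have E s t u v : a + (displacement s).1 + (displacement t).1 = u ->
    b + (displacement s).2 + (displacement t).2 = v ->
    move (move (a, b) s) t = (u, v) by move=> <- <-.
rewrite !andbF !andbT.
rewrite (E Stay (Plus ord0) (a + 1) b) ?(E Stay (Plus ord_max) a (b + 1)); try by rewrite /=; ring.
rewrite (E (Plus ord0) (Minus ord0) a b) ?(E (Plus ord0) (Minus ord_max) (a + 1) (b - 1)); try by rewrite /=; ring.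
rewrite (E (Plus ord_max) (Minus ord0) (a - 1) (b + 1)) ?(E (Plus ord_max) (Minus ord_max) a b); try by rewrite /=; ring.
rewrite (E (Minus ord0) Stay (a - 1) b) ?(E (Minus ord_max) Stay a (b - 1)); try by rewrite /=; ring.
rewrite /W2 /= !(addr0, subr0) hb.
have -> : (0 < b < a + 1) = true by lia.
have -> : (0 < b + 1 < a) = (b + 1 < a) by lia.
have H1 : 0 < b < a - 1 = false -> nwalks n (a - 1, b) y = 0%N.
  by move=> h; apply: nwalks_notin; rewrite /W2 /= h.
have H2 : 0 < b - 1 < a = false -> nwalks n (a, b - 1) y = 0%N.
  by move=> h; apply: nwalks_notin; rewrite /W2 /= h.
case: (0 < b < a - 1) H1 => H1; case: (0 < b - 1 < a) H2 => H2; case: (b + 1 < a); rewrite ?(H1 erefl) ?(H2 erefl) ?addn0 ?add0n //; lia.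
Qed.

Lemma nwalks_walk_count n (p q a b : int) : 0 < q < p -> 0 < b < a ->
  (nwalks n (a, b) (p, q))%:Z = walk_count n p q a b.
Proof.
move=> hp; elim: n a b => [|n IHn] a b hb.
  rewrite nwalks0 walk_count0 // /W2 /= hb; congr (nat_of_bool _)%:Z.
  by rewrite -pair_eqE /= eq_sym [b == q]eq_sym.
have W0 u v : v = 0 -> walk_count n p q u v = 0 by move=> ->; apply: alt_sum_axis.
have Wd u v : u = v -> walk_count n p q u v = 0 by move=> ->; apply: alt_sum_diag.
have N0 (u v : int) : (0 < v < u) = false -> (nwalks n (u, v) (p, q))%:Z = 0.
  by move=> h; rewrite nwalks_notin // /W2 /= h.
(* Points reached from the open chamber by one step of [step_sum] lie in the chamber or on a wall, except for [(a - 1, b + 1) = (b, a)] when [a = b + 1]. *)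
have NE (u v : int) : 0 <= v <= u -> (nwalks n (u, v) (p, q))%:Z = walk_count n p q u v.
  move=> huv; case: (boolP (0 < v < u)) => [/IHn //|/negbTE h].
  rewrite N0 //; have [/W0 //|v0] := eqVneq v 0.
  by rewrite Wd //; lia.
rewrite nwalksS_pairs // walk_countS /step_sum !PoszD !NE; try lia.
case: ifP => h; first by rewrite PoszD !NE; lia.
(* The pairs starting with [e_2] are now forbidden; their terms at [(b, a)] and [(a, b)] cancel by
   antisymmetry. *)
have -> : b + 1 = a by lia.
have -> : a - 1 = b by lia.
rewrite [walk_count n p q b a]alt_sumC -/(walk_count n p q a b); lia.
Qed.

(** * Telescoping the sum over endpoints *)

Lemma sum_shift_diff (phi : nat -> int) (N d : nat) :
  (forall i, (N <= i)%N -> phi i = 0) ->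
  \sum_(0 <= m < N) (phi m - phi (m + d)%N) = \sum_(0 <= i < d) phi i.
Proof.
move=> phi0; rewrite sumrB; apply/eqP; rewrite subr_eq; apply/eqP.
have -> : \sum_(0 <= m < N) phi m = \sum_(0 <= m < d + N) phi m.
  rewrite [RHS](@big_cat_nat _ _ _ N) ?leq_addl //= [X in _ + X]big_nat_cond.
  by rewrite [X in _ + X]big1 ?addr0 // => i /andP[/andP[/phi0]].
rewrite (@big_cat_nat _ _ _ d) ?leq_addr //=; congr (_ + _).
by rewrite -[X in \sum_(X <= _ < _) _ = _]add0n -[X in _ = \sum_(X <= _ < _) _]add0n big_addn addKn.
Qed.

Lemma sum_walk_count n :
  \sum_(0 <= m < n.+1) walk_count n (m%:Z + 2) 1 2 1 =
  coefS n 0 0 + 2 * coefS n 3 0 - 2 * coefS n 1 1 - coefS n 2 2.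
Proof.
(* Reflection in the direction of [e_1] pairs each group element with one of opposite sign and equal second coordinate. *)
pose phi (u v : int) (i : nat) := coefS n (i%:Z + u) v.
(* These bounds force [i + u > n] or [i + u + v > n] once [i > n], so [coefS_eq0] kills the tail. *)
have T u v d : - 1 <= u -> (0 <= u) || (0 < v) ->
    \sum_(0 <= m < n.+1) (phi u v m - phi u v (m + d)%N) = \sum_(0 <= i < d) phi u v i.
  move=> hu hv; apply: sum_shift_diff => i hi; apply: coefS_eq0; lia.
have -> : \sum_(0 <= m < n.+1) walk_count n (m%:Z + 2) 1 2 1 =
  \sum_(0 <= m < n.+1) (phi 0 0 m - phi 0 0 (m + 5)%N)
  - \sum_(0 <= m < n.+1) (phi 1 (-1) m - phi 1 (-1) (m + 4)%N)
  + \sum_(0 <= m < n.+1) (phi 3 (-2) m - phi 3 (-2) (m + 1)%N)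
  - \sum_(0 <= m < n.+1) (phi (-1) 2 m - phi (-1) 2 (m + 5)%N)
  + \sum_(0 <= m < n.+1) (phi (-1) 3 m - phi (-1) 3 (m + 4)%N)
  - \sum_(0 <= m < n.+1) (phi 0 4 m - phi 0 4 (m + 1)%N).
  rewrite -!(sumrB, big_split) /=; apply: eq_bigr => m _.
  rewrite /walk_count /alt_sum /rot_sum /phi !PoszD.
  have -> : m%:Z + 2 - 2 = m%:Z by ring.
  have -> : m%:Z + 2 - (2 + 1) = m%:Z - 1 by ring.
  have -> : m%:Z + 2 - 1 = m%:Z + 1 by ring.
  have -> : m%:Z + 2 - -2 = m%:Z + 4 by ring.
  have -> : m%:Z + 2 - - (2 + 1) = m%:Z + 5 by ring.
  have -> : m%:Z + 2 - -1 = m%:Z + 3 by ring.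
  have -> : m%:Z + 5%:Z + 0 = m%:Z + 5 by ring.
  have -> : m%:Z + 0 = m%:Z by ring.
  have -> : m%:Z + 4%:Z + 1 = m%:Z + 5 by ring.
  have -> : m%:Z + 1%:Z + 3 = m%:Z + 4 by ring.
  have -> : m%:Z + 5%:Z - 1 = m%:Z + 4 by ring.
  have -> : m%:Z + 4%:Z - 1 = m%:Z + 3 by ring.
  have -> : m%:Z + 1%:Z + 0 = m%:Z + 1 by ring.
  have -> : 1 - 1 = 0 :> int by [].
  have -> : 1 - -2 = 3 :> int by [].
  have -> : 1 - - (2 + 1) = 4 :> int by [].
  have -> : 1 - -1 = 2 :> int by [].
  have -> : 1 - 2 = -1 :> int by [].
  have -> : 1 - (2 + 1) = -2 :> int by [].
  ring.
rewrite !T //; rewrite !(big_nat_recr, big_geq) //= !add0r.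
(* The symmetries bring the 20 surviving terms to nonnegative coordinates in decreasing order, where
   most cancel. *)
have E32 : coefS n 3 (-2) = coefS n 2 1 by rewrite coefS_refl coefS_swap.
have E11 : coefS n 1 (-1) = coefS n 1 0 by rewrite coefS_refl coefS_swap.
have E21 : coefS n 2 (-1) = coefS n 1 1 by rewrite coefS_refl.
have E31 : coefS n 3 (-1) = coefS n 2 1 by rewrite coefS_refl.
have E41 : coefS n 4 (-1) = coefS n 3 1 by rewrite coefS_refl.
rewrite /phi
  -[0%:Z - 1]/(-1 : int) -[0%:Z + 0]/(0 : int) -[0%:Z + 1]/(1 : int) -[0%:Z + 3]/(3 : int) -[1%:Z - 1]/(0 : int)
  -[1%:Z + 0]/(1 : int) -[1%:Z + 1]/(2 : int) -[2%:Z - 1]/(1 : int) -[2%:Z + 0]/(2 : int) -[2%:Z + 1]/(3 : int)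
  -[3%:Z - 1]/(2 : int) -[3%:Z + 0]/(3 : int) -[3%:Z + 1]/(4 : int) -[4%:Z - 1]/(3 : int) -[4%:Z + 0]/(4 : int).
rewrite E11 E21 E31 E41 E32 !(coefS_swap n (-1)) E21 E31 !(coefS_swap n 0) !(coefS_swap n 1 _) (coefS_swap n 2 3); ring.
Qed.

(** * Determinants of binomials and the terms of the Baxter number *)

(* The determinant of the 3x3 matrix with entries ['C(n, k + i - j)]. *)
Definition bin_det3 (n : nat) (k : int) : int :=
  binz n k ^+ 3 + binz n (k + 1) ^+ 2 * binz n (k - 2) +
  binz n (k - 1) ^+ 2 * binz n (k + 2) -
  2 * (binz n k * binz n (k - 1) * binz n (k + 1)) -
  binz n k * binz n (k - 2) * binz n (k + 2).

Lemma sum_ord_shift (F : int -> int) n : F n%:Z = 0 -> F (-1) = 0 ->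
  \sum_(k < n.+1) F k%:Z = \sum_(k < n.+1) F (k%:Z - 1).
Proof.
move=> Fn F1; rewrite big_ord_recr big_ord_recl /= Fn F1 addr0 add0r.
by apply: eq_bigr => i _; congr F; rewrite /bump; lia.
Qed.

Lemma sum_bin_det3 n :
  \sum_(k < n.+1) bin_det3 n k%:Z =
  coefS n 0 0 + 2 * coefS n 3 0 - 2 * coefS n 1 1 - coefS n 2 2.
Proof.
(* The two copies of [coefS n 3 0] become the two mirror-image terms of the determinant containing a
   square, one of them through the swap. *)
have C30 : coefS n 3 0 = \sum_(k < n.+1) binz n (k%:Z + 1) ^+ 2 * binz n (k%:Z - 2).
  rewrite (@sum_ord_shift (fun k => binz n (k + 1) ^+ 2 * binz n (k - 2))).
  - apply: eq_bigr => k _; rewrite subrK addr0 -addrA; ring.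
  - by rewrite (@binz_small n (n%:Z + 1)) ?mul0r //; lia.
  - by rewrite (@binz_neg n (-1 - 2)) ?mulr0.
have C03 : coefS n 3 0 = \sum_(k < n.+1) binz n (k%:Z - 1) ^+ 2 * binz n (k%:Z + 2).
  rewrite coefS_swap /coefS (@sum_ord_shift (fun k => binz n k * binz n (k - 0) * binz n (k + 3))).
  - by apply: eq_bigr => k _; rewrite subr0 -expr2 -addrA.
  - by rewrite (@binz_small n (n%:Z + 3)) ?mulr0 //; lia.
  - by rewrite (@binz_neg n (-1)) ?mul0r.
rewrite mulrDl mul1r {1}C30 C03 /coefS !mulr_sumr -!(sumrB, big_split).
apply: eq_bigr => k _; rewrite /bin_det3 subr0 -[RHS]/(_ + (_ + _) - _ - _); ring.
Qed.

Lemma bin_fact_quot (n k j : nat) : n = (k + j)%N ->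
  'C(n, k)%:R = n`!%:R / (k`!%:R * j`!%:R) :> rat.
Proof.
move=> ->; have /(congr1 (fun m : nat => m%:R : rat)) := bin_fact (leq_addr j k).
by rewrite addKn !natrM => <-; rewrite mulfK // mulf_neq0 // pnatr_eq0 -lt0n fact_gt0.
Qed.

Lemma natrS_fact n : (n.+1)`!%:R = (n%:R + 1) * n`!%:R :> rat.
Proof. by rewrite factS natrM -natr1. Qed.

Lemma bin_det3E n k : (k <= n)%N ->
  (bin_det3 n k%:Z)%:~R =
  ('C(n.+2, k)%:R * 'C(n.+2, k.+1)%:R * 'C(n.+2, k.+2)%:R)
     / ('C(n.+2, 1)%:R * 'C(n.+2, 2)%:R) :> rat.
Proof.
move=> kn; have [j nE] : exists j, n = (k + j)%N by exists (n - k)%N; lia.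
(* All the binomials involved are polynomial multiples of [A], including those that vanish at the ends of the range of [k]. *)
pose A : rat := n`!%:R / (k.+2`!%:R * j.+2`!%:R).
have F0 m : m`!%:R != 0 :> rat by rewrite pnatr_eq0 -lt0n fact_gt0.
have P (m : nat) : (m%:R + 1 : rat) != 0 by rewrite natr1 pnatr_eq0.
have P2 (m : nat) : (m%:R + 1 + 1 : rat) != 0 by rewrite !natr1 pnatr_eq0.
have P3 (m : nat) : (m%:R + 1 + 1 + 1 : rat) != 0 by rewrite !natr1 pnatr_eq0.
have P4 (m : nat) : (m%:R + 1 + 1 + 1 + 1 : rat) != 0 by rewrite !natr1 pnatr_eq0.
have B0 : (binz n k%:Z)%:~R = A * ((k%:R + 2) * (k%:R + 1) * (j%:R + 2) * (j%:R + 1)).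
  rewrite [LHS](bin_fact_quot nE) /A !natrS_fact -!natr1; field.
  by rewrite !F0 !P !P2.
have B1 : (binz n (k%:Z + 1))%:~R = A * ((k%:R + 2) * (j%:R + 2) * (j%:R + 1) * j%:R).
  rewrite /A; case: (j) nE => [|i] nE; first by rewrite binz_small ?mulr0 //; lia.
  have -> : k%:Z + 1 = k.+1 by lia.
  rewrite [LHS](@bin_fact_quot n k.+1 i); last lia.
  rewrite !natrS_fact -!natr1; field.
  by rewrite !F0 !P !P2 !P3.
have B2 : (binz n (k%:Z + 2))%:~R = A * ((j%:R + 2) * (j%:R + 1) * j%:R * (j%:R - 1)).
  rewrite /A; case: (j) nE => [|[|i]] nE; try by rewrite binz_small ?subrr ?mulr0 ?mul0r ?mulr0 //; lia.
  have -> : k%:Z + 2 = k.+2 by lia.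
  rewrite [LHS](@bin_fact_quot n k.+2 i); last lia.
  rewrite !natrS_fact -!natr1; field.
  by rewrite !F0 !P !P2 !P3 !P4.
have Bm1 : (binz n (k%:Z - 1))%:~R = A * ((j%:R + 2) * (k%:R + 2) * (k%:R + 1) * k%:R).
  rewrite /A; case: (k) nE => [|i] nE; first by rewrite binz_neg ?mulr0 //; lia.
  have -> : i.+1%:Z - 1 = i by lia.
  rewrite [LHS](@bin_fact_quot n i j.+1); last lia.
  rewrite !natrS_fact -!natr1; field.
  by rewrite !F0 !P !P2 !P3.
have Bm2 : (binz n (k%:Z - 2))%:~R = A * ((k%:R + 2) * (k%:R + 1) * k%:R * (k%:R - 1)).
  rewrite /A; case: (k) nE => [|[|i]] nE; try by rewrite binz_neg ?subrr ?mulr0 ?mul0r ?mulr0 //; lia.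
  have -> : i.+2%:Z - 2 = i by lia.
  rewrite [LHS](@bin_fact_quot n i j.+2); last lia.
  rewrite !natrS_fact -!natr1; field.
  by rewrite !F0 !P !P2 !P3 !P4.
have D0 : 'C(n.+2, k)%:R = A * ((n%:R + 2) * (n%:R + 1) * (k%:R + 2) * (k%:R + 1)).
  rewrite (@bin_fact_quot n.+2 k j.+2); last lia.
  rewrite /A !natrS_fact -!natr1; field.
  by rewrite !F0 !P !P2.
have D1 : 'C(n.+2, k.+1)%:R = A * ((n%:R + 2) * (n%:R + 1) * (k%:R + 2) * (j%:R + 2)).
  rewrite (@bin_fact_quot n.+2 k.+1 j.+1); last lia.
  rewrite /A !natrS_fact -!natr1; field.
  by rewrite !F0 !P !P2.
have D2 : 'C(n.+2, k.+2)%:R = A * ((n%:R + 2) * (n%:R + 1) * (j%:R + 2) * (j%:R + 1)).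
  rewrite (@bin_fact_quot n.+2 k.+2 j); last lia.
  rewrite /A !natrS_fact -!natr1; field.
  by rewrite !F0 !P !P2.
have E2 : 'C(n.+2, 2)%:R = (n%:R + 2) * (n%:R + 1) / 2 :> rat.
  rewrite (@bin_fact_quot n.+2 2 n) // !natrS_fact fact0 -!natr1; field.
  by rewrite F0.
rewrite D0 D1 D2 E2 bin1 /bin_det3 !exprS expr0 !(intrD, mulrNz, intrM) B0 B1 B2 Bm1 Bm2.
(* Both sides are [A ^+ 3] times a rational function of [k] and [j], with denominators built from
   [k + j + 1] and [k + j + 2]. *)
rewrite -!natr1 nE natrD; field.
by rewrite -!natrD natr1 !pnatr_eq0 addn2.
Qed.

Theorem theorem2 (n : nat) :
  (\sum_(0 <= m < n.+1) ell2 m n)%:R = baxter n.+1.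
Proof.
have -> : (\sum_(0 <= m < n.+1) ell2 m n)%:R =
    (\sum_(0 <= m < n.+1) walk_count n (m%:Z + 2) 1 2 1)%:~R :> rat.
  rewrite natr_sum rmorph_sum; apply: eq_bigr => m _ /=.
  rewrite -nwalks_walk_count; [|lia..].
  by rewrite /ell2 /L2 card_hesitating_walks.
rewrite sum_walk_count -sum_bin_det3 rmorph_sum /baxter big_add1 big_mkord.
by apply: eq_bigr => k _; apply: bin_det3E; rewrite -ltnS.
Qed.
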